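(* For a positive integer $r$ let $P(r)=\min\{2^s : s\in\mathbb{N},\ 2^s\ge r\}$. Let $n,m$ be positive integers. Then $$P(n)\ge m+2\iff n\ge\tfrac12P(m+2)+1,$$ and if these equivalent conditions hold, then $(n,m,2)\in\mathcal{R}_{odd,sym}^{orth}$.
   Context: A continuous function $f:S^{n-1}\times S^{n-1}\to\mathbb{R}$ is called odd if $f(-x,y)=-f(x,y)$ and $f(x,-y)=-f(x,y)$ for all $x,y$, and symmetric if $f(x,y)=f(y,x)$ for all $x,y$. $\mathcal{R}_{odd,sym}^{orth}$ is the set of triples $(n,m,k)$ of positive integers such that for any $m$ odd and symmetric functions $f_1,\ldots,f_m:S^{n-1}\times S^{n-1}\to\mathbb{R}$ there exists an orthonormal $k$-frame $(e_1,\ldots,e_k)$ in $\mathbb{R}^n$ with $f_l(e_i,e_j)=0$ for all $1\le l\le m$ and $1\le i<j\le k$. *)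

(* Defs.v *)
From HB Require Import structures.
From mathcomp Require Import all_boot all_order all_algebra.
From mathcomp Require Import all_classical all_reals all_analysis.

Set Implicit Arguments.
Unset Strict Implicit.
Unset Printing Implicit Defensive.

Import Order.TTheory GRing.Theory Num.Theory.
Import numFieldNormedType.Exports.

Local Open Scope classical_set_scope.
Local Open Scope ring_scope.

Definition pow2_ge (r : nat) : pred nat :=
  fun p => `[< exists s : nat, p = (2 ^ s)%N /\ (r <= 2 ^ s)%N >].

Lemma pow2_ge_ex (r : nat) : exists p, pow2_ge r p.
Proof. by exists (2 ^ r)%N; apply/asboolP; exists r; split=> //; exact/ltnW/ltn_expl. Qed.

Definition P (r : nat) : nat := ex_minn (pow2_ge_ex r).

(* The norm that the library puts on 'rV[R]_n is the sup norm (it induces the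
   usual topology), so the Euclidean structure is given explicitly. *)
Definition dotv (R : realType) (n : nat) (u v : 'rV[R]_n) : R :=
  \sum_(i < n) u ord0 i * v ord0 i.

Definition sphere (R : realType) (n : nat) : set 'rV[R]_n :=
  [set x | dotv x x = 1].
Arguments sphere : clear implicits.

(* A function on S^{n-1} x S^{n-1} is represented by a total function on pairs
   of vectors; the predicates below only look at its values on the spheres. *)
Definition sphere_continuous (R : realType) (n : nat)
    (f : 'rV[R]_n -> 'rV[R]_n -> R) : Prop :=
  {within sphere R n `*` sphere R n, continuous (fun z => f z.1 z.2)}.

Definition odd_fun (R : realType) (n : nat)
    (f : 'rV[R]_n -> 'rV[R]_n -> R) : Prop :=
  forall x y, sphere R n x -> sphere R n y ->
    f (- x) y = - f x y /\ f x (- y) = - f x y.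

Definition sym_fun (R : realType) (n : nat)
    (f : 'rV[R]_n -> 'rV[R]_n -> R) : Prop :=
  forall x y, sphere R n x -> sphere R n y -> f x y = f y x.

Definition orthonormal_frame (R : realType) (n k : nat)
    (e : 'I_k -> 'rV[R]_n) : Prop :=
  forall i j : 'I_k, dotv (e i) (e j) = (i == j)%:R.

Definition R_odd_sym_orth (R : realType) : set (nat * nat * nat) :=
  [set t | let: (n, m, k) := t in
    [/\ (0 < n)%N, (0 < m)%N, (0 < k)%N &
     forall f : 'I_m -> 'rV[R]_n -> 'rV[R]_n -> R,
       (forall l, [/\ sphere_continuous (f l), odd_fun (f l) & sym_fun (f l)]) ->
       exists2 e : 'I_k -> 'rV[R]_n, orthonormal_frame e &
         forall (l : 'I_m) (i j : 'I_k), (i < j)%N -> f l (e i) (e j) = 0]].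

(* Main.v *)
Require Import Defs.
From mathcomp Require Import all_boot all_order all_algebra.
From mathcomp Require Import all_classical all_reals all_analysis.
From mathcomp Require Import lra zify.

Import Order.TTheory GRing.Theory Num.Theory.
Import numFieldNormedType.Exports.

Local Open Scope classical_set_scope.
Local Open Scope ring_scope.

Set Implicit Arguments.
Unset Strict Implicit.
Unset Printing Implicit Defensive.

(** Why the theorem is true. Write 2^t < m + 2 <= 2^(t+1). Then both numerical
    conditions say 2^t < n. For the second part, a = 2^t - 1 and b = 2^t satisfy
    a < n, b < n and a + b = 2^(t+1) - 1 >= m + 1, and the binomial coefficient
    of a + b over a is odd ([odd_bin_pow2]). So it suffices to apply the
    following Borsuk-Ulam type theorem to the m given functions and to the inner
    product, whose vanishing makes the common zero orthonormal
    ([biodd_common_zero]): if a, b < n and the binomial coefficient of a + b over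
    a is odd, then any a + b continuous functions on pairs of unit vectors that
    are odd in each variable have a common zero.

    That theorem is proved with mod 2 simplicial chains. Ordered simplices with
    vertices in R^n x R^n are sequences, chains are lists of simplices, and
    cochains are boolean functions summed by exclusive or. Let X and Y be the
    sign changes of the two components of a pair.

    - By iterated coning one builds a chain D(i, j) of dimension i + j, which
      represents the product of an upper hemisphere of dimension i and one of
      dimension j, and has boundary (1 + X) D(i - 1, j) + (1 + Y) D(i, j - 1)
      ([xsum_boundary_prodchain]). Its vertices are pairs of signed basis
      vectors, and the two components of each simplex lie in single faces of the
      l1 spheres. Barycentric subdivision keeps the boundary relation, because
      it commutes with the coboundary and with the sign changes ([cobd_subdiv],
      [subdiv_cochain_map]), and it makes the simplices arbitrarily small
      ([small_iter_subdiv]).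

    - A boolean function g of the vertices that is negated by X and by Y has a
      coboundary that is invariant. The cup product of k such coboundaries
      ([cup]) is the coboundary of [precup], and precup plus its image under X
      or Y is the cup product of k - 1 of them. Hence the value of the cup
      product of i + j coboundaries on D(i, j) satisfies the Pascal recursion,
      and is the binomial coefficient of i + j over i modulo 2
      ([xsum_cup_prodchain]).

    - Take for the functions g the signs of the a + b given functions. When the
      binomial coefficient is odd, the cup product is nonzero on some simplex of
      every iterated subdivision of D(a, b); on such a simplex each of the given
      functions changes sign ([small_sign_changing_simplex]). A cluster point of
      these ever smaller simplices is a common zero. *)

(** * Chains and cochains modulo 2 *)

(** The sum modulo 2 of the booleans [F x], for [x] in the list [r]. A chain
    is a list of simplices; identities between chains are stated through the
    sums of arbitrary cochains over them. *)
Notation xsum r F := (\big[addb/false]_(x <- r) F x).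

Section Chains.
Variable V : Type.
Implicit Types (s t : seq V) (c d : seq (seq V)) (phi psi : seq V -> bool).

(** The simplices obtained by dropping one vertex. The faces include the empty
    simplex, so the complex is augmented. *)
Fixpoint faces s : seq (seq V) :=
  if s is v :: t then t :: map (cons v) (faces t) else [::].

Definition boundary c : seq (seq V) := flatten (map faces c).

(** The coboundary of the cochain [phi]. *)
Definition cobd phi s : bool := xsum (faces s) phi.

Lemma xsum_flatmap (T U : Type) (h : T -> seq U) (c : seq T) (phi : U -> bool) :
  xsum (flatten (map h c)) phi = xsum c (fun x => xsum (h x) phi).
Proof. by rewrite big_flatten big_map. Qed.

Lemma xsum_boundary c phi : xsum (boundary c) phi = xsum c (cobd phi).
Proof. exact: xsum_flatmap. Qed.

(** The boundary of a cone, in dual form. *)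
Lemma cobd_cons phi v s :
  cobd phi (v :: s) = phi s (+) cobd (fun t => phi (v :: t)) s.
Proof. by rewrite /cobd /= big_cons big_map. Qed.

Lemma xsumD (T : Type) (r : seq T) (phi psi : T -> bool) :
  xsum r (fun x => phi x (+) psi x) = xsum r phi (+) xsum r psi.
Proof. exact: big_split. Qed.

Lemma cobdD phi psi s :
  cobd (fun t => phi t (+) psi t) s = cobd phi s (+) cobd psi s.
Proof. exact: xsumD. Qed.

Lemma eq_xsum (T : Type) (r : seq T) (phi psi : T -> bool) :
  phi =1 psi -> xsum r phi = xsum r psi.
Proof. by move=> e; apply: eq_bigr => t _; exact: e. Qed.

Lemma xsum0 (T : Type) (r : seq T) (phi : T -> bool) :
  (forall x, phi x = false) -> xsum r phi = false.
Proof. by move=> e; apply: big1 => t _; exact: e. Qed.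

Lemma cobd_cobd phi s : cobd (cobd phi) s = false.
Proof.
elim: s phi => [|v s IH] phi; first by rewrite /cobd big_nil.
rewrite cobd_cons.
have -> : cobd (fun t => cobd phi (v :: t)) s =
    cobd phi s (+) cobd (cobd (fun t => phi (v :: t))) s.
  by rewrite -cobdD; apply: eq_xsum => t; rewrite cobd_cons.
by rewrite IH addbF addbb.
Qed.

(** The cup product of the coboundaries of the 0-cochains in [gs]: on a simplex
    with one vertex more than [gs] has entries, it is true when the l-th entry
    takes different values on the l-th and the next vertex, for every l. It is
    false on the simplices of any other dimension. *)
Fixpoint cup (gs : seq (V -> bool)) s : bool :=
  match gs, s with
  | [::], [:: _] => true
  | g :: gs', u :: (v :: _) as t => (g u (+) g v) && cup gs' t
  | _, _ => false
  end.

Lemma cup_size gs s : cup gs s -> size s = (size gs).+1.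
Proof.
elim: gs s => [|g gs IH] [|u [|v s]] //= /andP[_ /IH /= ->] //.
Qed.

(** The cup product of the 0-cochain [g] with [cup gs]. *)
Definition precup (g : V -> bool) gs s : bool :=
  if s is v :: _ then g v && cup gs s else false.

(** A cup product of coboundaries is a cocycle, and [cup (g :: gs)] is the
    coboundary of [precup g gs]. The first fact for [gs] gives the second for
    [gs], which gives the first for [g :: gs], since coboundaries are cocycles. *)
Lemma cobd_cup_precup gs : (forall s, cobd (cup gs) s = false) /\
  forall g s, cobd (precup g gs) s = cup (g :: gs) s.
Proof.
have step hs : (forall s, cobd (cup hs) s = false) ->
    forall g s, cobd (precup g hs) s = cup (g :: hs) s.
  move=> cocyc g [|v s]; first by rewrite /cobd big_nil.
  have E : cobd (fun t => cup hs (v :: t)) s = cup hs s.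
    have := cocyc (v :: s); rewrite cobd_cons.
    by case: (cup hs s); case: (cobd _ _).
  rewrite cobd_cons.
  have -> : cobd (fun t => precup g hs (v :: t)) s = g v && cup hs s.
    rewrite -E /cobd /=; elim: (faces s) => [|t r IH]; first by rewrite !big_nil andbF.
    by rewrite !big_cons IH; case: (g v).
  case: s {E} => [|u s]; first by case: hs cocyc => *; rewrite /= andbF.
  by rewrite /=; case: (g u); case: (g v); case: (cup _ _).
elim: gs => [|g gs [IH1 IH2]]; last first.
  have c1 s : cobd (cup (g :: gs)) s = false.
    by rewrite -(cobd_cobd (precup g gs) s); apply: eq_xsum => t; rewrite IH2.
  by split=> //; apply: step.
have c1 s : cobd (cup [::]) s = false.
  case: s => [|u [|v [|w s]]]; rewrite /cobd /= ?big_cons ?big_nil //=.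
  by rewrite !big_map xsum0.
by split=> //; apply: step.
Qed.

Lemma cobd_precup g gs s : cobd (precup g gs) s = cup (g :: gs) s.
Proof. by have [_] := cobd_cup_precup gs. Qed.

(** The chain [(1 + nu) c]. *)
Definition symm (nu : V -> V) c := c ++ map (map nu) c.

Lemma xsum_symm nu c phi :
  xsum (symm nu c) phi = xsum c (fun s => phi s (+) phi (map nu s)).
Proof. by rewrite big_cat big_map xsumD. Qed.

Lemma faces_map nu s : faces (map nu s) = map (map nu) (faces s).
Proof.
elim: s => //= v s ->; congr cons.
by rewrite -!map_comp; apply: eq_map => t.
Qed.

Lemma cobd_map nu phi s : cobd phi (map nu s) = cobd (fun t => phi (map nu t)) s.
Proof. by rewrite /cobd faces_map big_map. Qed.

Lemma xsum_boundary_symm nu c phi :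
  xsum (boundary (symm nu c)) phi =
  xsum (boundary c) (fun s => phi s (+) phi (map nu s)).
Proof.
rewrite !xsum_boundary xsum_symm; apply: eq_xsum => s.
by rewrite cobd_map -cobdD.
Qed.

(** * The product of two hemispheres as an iterated cone *)

Variables X Y : V -> V.
Variable apex : nat -> nat -> V.

(** The chain D(i, j), for [k = i + j]: the cone with apex [apex i j] over
    (1 + X) D(i - 1, j) + (1 + Y) D(i, j - 1), where a term with a negative index
    is omitted. D(0, 0) is the single vertex [apex 0 0]. The argument [k] only
    makes the recursion structural. *)
Fixpoint prodchain (k i j : nat) : seq (seq V) :=
  if k is k'.+1 then
    map (cons (apex i j))
      ((if i is i'.+1 then symm X (prodchain k' i' j) else [::]) ++
       (if j is j'.+1 then symm Y (prodchain k' i j') else [::]))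
  else [:: [:: apex i j]].

(** The base of the cone D(i, j), for [k.+1 = i + j]. *)
Definition prodchain_faces k i j : seq (seq V) :=
  (if i is i'.+1 then symm X (prodchain k i' j) else [::]) ++
  (if j is j'.+1 then symm Y (prodchain k i j') else [::]).

Hypothesis XK : involutive X.
Hypothesis YK : involutive Y.
Hypothesis XY : forall v, X (Y v) = Y (X v).

Lemma xsum_boundary_cone v c phi :
  xsum (boundary (map (cons v) c)) phi =
  xsum c phi (+) xsum (boundary c) (fun s => phi (v :: s)).
Proof.
by rewrite !xsum_boundary big_map -xsumD; apply: eq_xsum => s; rewrite cobd_cons.
Qed.

(** The boundary of the cone D(i, j) is its base, because the base is a cycle:
    (1 + X)(1 + X) and (1 + Y)(1 + Y) vanish modulo 2, and the two mixed terms,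
    which involve D(i - 1, j - 1), cancel as X and Y commute. *)
Lemma xsum_boundary_prodchain k i j phi : (i + j = k.+1)%N ->
  xsum (boundary (prodchain k.+1 i j)) phi = xsum (prodchain_faces k i j) phi.
Proof.
have catbd c d psi : xsum (boundary (c ++ d)) psi =
    xsum (boundary c) psi (+) xsum (boundary d) psi.
  by rewrite !xsum_boundary big_cat.
have bdnil psi : xsum (boundary [::]) psi = false by rewrite xsum_boundary big_nil.
have map_inv nu : involutive nu -> involutive (map nu : seq V -> seq V).
  by move=> nuK s; rewrite mapK.
elim: k i j phi => [|k IH] i j phi ijk; rewrite [prodchain _ _ _]/= xsum_boundary_cone;
  rewrite -/(prodchain_faces _ i j) [X in _ (+) X](_ : _ = false) ?addbF //.
  (* a pair of points bounds the empty simplex twice *)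
  rewrite /prodchain_faces catbd.
  case: i j ijk => [|[|i]] [|[|j]] //= _; rewrite ?bdnil ?xsum_boundary_symm xsum_boundary /=;
  by rewrite !big_cons !big_nil /cobd /= !big_cons !big_nil; case: (phi _).
rewrite /prodchain_faces catbd.
have key c1 c2 psi : xsum (c1 ++ c2) psi = xsum c1 psi (+) xsum c2 psi.
  by rewrite big_cat.
have EX c psi : xsum (symm X c) (fun s => psi s (+) psi (map X s)) = false.
  by rewrite xsum_symm xsum0 // => s; rewrite (map_inv _ XK); case: (psi s); case: (psi _).
have EY c psi : xsum (symm Y c) (fun s => psi s (+) psi (map Y s)) = false.
  by rewrite xsum_symm xsum0 // => s; rewrite (map_inv _ YK); case: (psi s); case: (psi _).
have XYm s : map X (map Y s) = map Y (map X s).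
  by rewrite -!map_comp; apply: eq_map => v /=.
case: i j ijk => [|i] [|j] //= ijk; rewrite ?bdnil ?xsum_boundary_symm IH //;
  try (by lia); rewrite /prodchain_faces ?cats0 ?key.
- by case: j ijk => [|j] _; rewrite ?big_nil //= EY.
- by case: i ijk => [|i] _; rewrite ?big_nil //= EX.
rewrite IH; last by lia.
have -> psi : xsum (if i is i'.+1 then symm X (prodchain k i' j.+1) else [::])
    (fun s => psi s (+) psi (map X s)) = false.
  by case: i {ijk} => [|i]; rewrite ?big_nil ?EX.
rewrite /prodchain_faces key.
have -> psi : xsum (if j is j'.+1 then symm Y (prodchain k i.+1 j') else [::])
    (fun s => psi s (+) psi (map Y s)) = false.
  by case: j {ijk} => [|j]; rewrite ?big_nil ?EY.
rewrite addFb addbF xsum_symm !big_map -!xsumD xsum0 // => s.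
rewrite XYm; do 4 case: (phi _) => //.
Qed.

End Chains.

(** * Barycentric subdivision *)

Lemma mem_faces (T : eqType) (s t : seq T) : t \in faces s ->
  size s = (size t).+1 /\ {subset t <= s}.
Proof.
elim: s t => // v s IH t; rewrite inE => /predU1P[->|/mapP[u /IH[E sub] ->]].
  by split=> // x xs; rewrite inE xs orbT.
split=> /=; first by rewrite E.
move=> x; rewrite !inE => /predU1P[->|/sub ->]; rewrite ?eqxx ?orbT //.
Qed.

Lemma eq_cobd (T : eqType) (phi psi : seq T -> bool) s :
  {in faces s, phi =1 psi} -> cobd phi s = cobd psi s.
Proof. exact: eq_big_seq. Qed.

Section Subdivision.
Variables (R : realType) (V : lmodType R).
Implicit Types (s t : seq V) (phi psi : seq V -> bool).

(** The barycenter (0 for the empty sequence, a value that plays no role). *)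
Definition bary s : V := (size s)%:R^-1 *: \sum_(v <- s) v.

(** The barycentric subdivision of a simplex with [n] vertices. *)
Fixpoint subdiv_rec (n : nat) s : seq (seq V) :=
  if n is n'.+1 then map (cons (bary s)) (flatten (map (subdiv_rec n') (faces s)))
  else [:: [::]].

Definition subdiv s := subdiv_rec (size s) s.

(** The pullback of the cochain [phi] by barycentric subdivision. *)
Definition subdiv_cochain phi s : bool := xsum (subdiv s) phi.

Lemma subdivE s : s != [::] ->
  subdiv s = map (cons (bary s)) (flatten (map subdiv (faces s))).
Proof.
case: s => // v s _.
transitivity (map (cons (bary (v :: s)))
    (flatten (map (subdiv_rec (size s)) (faces (v :: s)))));
  first by [].
congr (map _ (flatten _)).
by apply/eq_in_map => t /mem_faces[[E] _]; rewrite /subdiv E.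
Qed.

Lemma subdiv_cochainD phi psi s :
  subdiv_cochain (fun t => phi t (+) psi t) s =
  subdiv_cochain phi s (+) subdiv_cochain psi s.
Proof. exact: xsumD. Qed.

Lemma subdiv_cochainE phi s : s != [::] ->
  subdiv_cochain phi s = cobd (subdiv_cochain (fun t => phi (bary s :: t))) s.
Proof. by move=> s0; rewrite /subdiv_cochain subdivE // big_map xsum_flatmap. Qed.

(** Barycentric subdivision is a chain map. *)
Lemma cobd_subdiv phi s : cobd (subdiv_cochain phi) s = subdiv_cochain (cobd phi) s.
Proof.
have [n] := ubnP (size s); elim: n phi s => // n IH phi s sn.
have [->|s0] := eqVneq s [::].
  by rewrite /cobd /subdiv_cochain /subdiv /= big_seq1 !big_nil.
rewrite [RHS]subdiv_cochainE //.
have -> : cobd (subdiv_cochain (fun t => cobd phi (bary s :: t))) s =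
  cobd (fun f => subdiv_cochain phi f (+)
                 cobd (subdiv_cochain (fun t => phi (bary s :: t))) f) s.
  apply: eq_cobd => f /mem_faces[E _].
  rewrite IH; last by rewrite -ltnS -E.
  by rewrite -subdiv_cochainD; apply: eq_xsum => t; rewrite cobd_cons.
by rewrite cobdD cobd_cobd addbF.
Qed.

(** Barycentric subdivision is natural for maps that preserve barycenters. *)
Lemma subdiv_cochain_map (X : V -> V)
    (HX : forall s, bary (map X s) = X (bary s)) phi s :
  subdiv_cochain phi (map X s) = subdiv_cochain (fun t => phi (map X t)) s.
Proof.
have [n] := ubnP (size s); elim: n phi s => // n IH phi s sn.
have [->|s0] := eqVneq s [::].
  by rewrite /cobd /subdiv_cochain /subdiv /= !big_seq1.
rewrite !subdiv_cochainE //; last by case: (s) s0.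
rewrite cobd_map; apply: eq_cobd => f /mem_faces[E _].
rewrite IH; last by rewrite -ltnS -E.
by apply: eq_xsum => t /=; rewrite HX.
Qed.

(** The simplices of the [N]-th barycentric subdivision. *)
Fixpoint iter_subdiv (N : nat) s : seq (seq V) :=
  if N is N'.+1 then flatten (map (iter_subdiv N') (subdiv s)) else [:: s].

(** The pullback of the cochain [phi] by the [N]-th subdivision. *)
Definition iter_cochain N phi s : bool := xsum (iter_subdiv N s) phi.

Lemma iter_cochain0 phi s : iter_cochain 0 phi s = phi s.
Proof. by rewrite /iter_cochain big_seq1. Qed.

Lemma iter_cochainS N phi s : iter_cochain N.+1 phi s = subdiv_cochain (iter_cochain N phi) s.
Proof. by rewrite /iter_cochain /= xsum_flatmap. Qed.

Lemma iter_cochainD N phi psi s :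
  iter_cochain N (fun t => phi t (+) psi t) s = iter_cochain N phi s (+) iter_cochain N psi s.
Proof. exact: xsumD. Qed.

Lemma cobd_iter_cochain N phi s : cobd (iter_cochain N phi) s = iter_cochain N (cobd phi) s.
Proof.
elim: N s => [|N IH] s.
  by rewrite iter_cochain0; apply: eq_xsum => t; rewrite iter_cochain0.
rewrite iter_cochainS.
have -> : cobd (iter_cochain N.+1 phi) s = cobd (subdiv_cochain (iter_cochain N phi)) s.
  by apply: eq_xsum => t; rewrite iter_cochainS.
by rewrite cobd_subdiv; apply: eq_xsum => t; rewrite IH.
Qed.

Lemma iter_cochain_map (X : V -> V)
    (HX : forall s, bary (map X s) = X (bary s)) N phi s :
  iter_cochain N phi (map X s) = iter_cochain N (fun t => phi (map X t)) s.
Proof.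
elim: N s => [|N IH] s; first by rewrite !iter_cochain0.
by rewrite !iter_cochainS subdiv_cochain_map //; apply: eq_xsum => t; rewrite IH.
Qed.

(** A substitute for convexity: [Q] holds at the barycenter of any nonempty
    sequence of points at which it holds. Then it passes from the vertices of a
    simplex to those of its subdivisions. *)
Definition bary_closed (Q : V -> Prop) :=
  forall s, s != [::] -> (forall v, v \in s -> Q v) -> Q (bary s).

Lemma subdiv_closed Q s t : bary_closed Q -> (forall v, v \in s -> Q v) ->
  t \in subdiv s -> forall v, v \in t -> Q v.
Proof.
move=> HQ; have [n] := ubnP (size s); elim: n s t => // n IH s t sn Qs.
have [->|s0] := eqVneq s [::]; first by rewrite inE => /eqP->.
rewrite subdivE // => /mapP[u /flatten_mapP[f ff uf] ->] v.
rewrite inE => /predU1P[->|vu]; first exact: HQ.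
have [E sub] := mem_faces ff.
by apply: (IH f u _ _ uf v vu) => [|w /sub /Qs//]; rewrite -ltnS -E.
Qed.

Lemma iter_subdiv_closed Q N s t : bary_closed Q -> (forall v, v \in s -> Q v) ->
  t \in iter_subdiv N s -> forall v, v \in t -> Q v.
Proof.
move=> HQ; elim: N s => [|N IH] s Qs /=; first by rewrite inE => /eqP->.
by move=> /flatten_mapP[u us tu]; apply: (IH u) => // v; apply: subdiv_closed us v.
Qed.

Lemma size_subdiv s t : t \in subdiv s -> size t = size s.
Proof.
have [n] := ubnP (size s); elim: n s t => // n IH s t sn.
have [->|s0] := eqVneq s [::]; first by rewrite inE => /eqP->.
rewrite subdivE // => /mapP[u /flatten_mapP[f /mem_faces[E _] uf] ->] /=.
by rewrite E (IH _ _ _ uf) // -ltnS -E.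
Qed.

(** * The value of the cup product on the product of hemispheres *)

Variables (X Y : V -> V) (apex : nat -> nat -> V).
Hypothesis XK : involutive X.
Hypothesis YK : involutive Y.
Hypothesis XY : forall v, X (Y v) = Y (X v).
Hypothesis HX : forall s, bary (map X s) = X (bary s).
Hypothesis HY : forall s, bary (map Y s) = Y (bary s).
Variables (good : V -> Prop) (N a b : nat).
Hypothesis HK : forall k i j s t v, (i + j = k)%N -> (i <= a)%N -> (j <= b)%N ->
  s \in prodchain X Y apex k i j -> t \in iter_subdiv N s -> v \in t -> good v.

(** The function [g] is negated by [X] and by [Y] at the points under
    consideration. *)
Definition odd_sign (g : V -> bool) := forall v, good v ->
  g (X v) = ~~ g v /\ g (Y v) = ~~ g v.

Lemma cup_map (Z : V -> V) gs t :
  (forall g, List.In g gs -> forall v, v \in t -> g (Z v) = ~~ g v) ->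
  cup gs (map Z t) = cup gs t.
Proof.
elim: gs t => [|g gs IH] [|u [|v t]] //= H.
rewrite !H ?inE ?eqxx ?orbT //; last by left.
have /= -> := IH (v :: t).
  by rewrite addbN addNb negbK.
move=> h hg w wt; apply: H; first by right.
by rewrite inE wt orbT.
by left.
Qed.

(** A 0-cochain that the sign change negates satisfies g + g o Z = 1, which
    brings the degree of the cup product down by one. *)
Lemma precup_map (Z : V -> V) g gs t :
  (forall h, List.In h (g :: gs) -> forall v, v \in t -> h (Z v) = ~~ h v) ->
  precup g gs t (+) precup g gs (map Z t) = cup gs t.
Proof.
move=> H; have := @cup_map Z gs t; case: t H => [|v t] H /= E; first by case: gs {H E}.
rewrite E; last by move=> h hg w wt; apply: H => //; right.
rewrite H ?inE ?eqxx //; last by left.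
by case: (g v); case: (cup _ _).
Qed.

(** Stokes and the boundary relation of [prodchain] turn the value of a cup
    product of degree i + j on D(i, j) into the sum of the values of the product
    without its first factor on D(i - 1, j) and on D(i, j - 1). *)
Lemma xsum_cup_prodchain gs i j : (size gs = i + j)%N -> (i <= a)%N -> (j <= b)%N ->
  (forall g, List.In g gs -> odd_sign g) ->
  xsum (prodchain X Y apex (i + j) i j) (iter_cochain N (cup gs)) = odd 'C(i + j, i).
Proof.
elim: gs i j => [|g gs IH] i j.
  case: i j => [|i] [|j] //= _ _ _ _; rewrite big_seq1.
  elim: N (apex 0 0)%N => [|N' IH] v; first by rewrite iter_cochain0.
  by rewrite iter_cochainS {1}/subdiv_cochain
    (_ : subdiv [:: v] = [:: [:: bary [:: v]]]) // big_seq1 IH.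
move=> /esym ijk ia jb Hg; rewrite /= in ijk; rewrite ijk.
rewrite (@eq_xsum _ _ _ (cobd (iter_cochain N (precup g gs)))); last first.
  by move=> s; rewrite cobd_iter_cochain; apply: eq_xsum => t; rewrite cobd_precup.
rewrite -xsum_boundary xsum_boundary_prodchain //.
(* Both faces contribute in the same way; Z is one of the two sign changes. *)
have E (Z : V -> V) i' j' : Z = X \/ Z = Y -> (i' + j' = size gs)%N -> (i' <= a)%N ->
    (j' <= b)%N ->
    xsum (symm Z (prodchain X Y apex (size gs) i' j'))
      (iter_cochain N (precup g gs)) = odd 'C(i' + j', i').
  move=> HZ ij' ia' jb'; rewrite xsum_symm -IH //; last first.
    by move=> h hg; apply: Hg; right.
  rewrite ij'; apply: eq_big_seq => s sD.
  have -> : iter_cochain N (precup g gs) (map Z s) =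
      iter_cochain N (fun t => precup g gs (map Z t)) s.
    by case: HZ => ->; rewrite iter_cochain_map.
  rewrite -iter_cochainD; apply: eq_big_seq => t ts; apply: precup_map => h hg v vt.
  have [] := Hg h hg v (HK ij' ia' jb' sD ts vt).
  by case: HZ => ->.
rewrite /prodchain_faces big_cat /=.
case: i j ijk ia jb => [|i] [|j] //= ijk ia jb; rewrite ?big_nil.
- by rewrite E ?bin0 //; [right | lia | lia].
- by rewrite E; [rewrite addbF -ijk !addn0 !binn | left | lia | lia | lia].
- rewrite !E; try lia; try (by left); try (by right).
  by rewrite -ijk [in RHS]addSn binS oddD addbC addSnnS.
Qed.

End Subdivision.

(** * Subdivisions become small *)

Section Mesh.
Variables (R : realType) (V : normedModType R).
Implicit Types (s t : seq V).

(** The simplex [s] has diameter at most [e]. *)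
Definition small (e : R) s := forall u v, u \in s -> v \in s -> `|u - v| <= e.

Lemma norm_sub_bary_le (c : V) s : s != [::] ->
  `|c - bary s| <= (size s)%:R^-1 * \sum_(v <- s) `|c - v|.
Proof.
move=> s0; have n0 : (size s)%:R != 0 :> R by rewrite pnatr_eq0 size_eq0.
have -> : c - bary s = (size s)%:R^-1 *: \sum_(v <- s) (c - v).
  rewrite big_split /= sumrN scalerDr scalerN; congr (_ - _).
  rewrite big_const_seq count_predT iter_addr_0 -[c *+ _]scaler_nat scalerA.
  by rewrite mulVf ?scale1r.
rewrite normrZ ger0_norm ?invr_ge0 // ler_wpM2l ?invr_ge0 //.
exact: ler_norm_sum.
Qed.

Lemma bary_closed_ball (c : V) (e : R) : bary_closed (fun v => `|c - v| <= e).
Proof.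
move=> s s0 Hs; apply: (le_trans (norm_sub_bary_le c s0)).
rewrite ler_pdivrMl ?ltr0n ?lt0n ?size_eq0 //.
have -> : (size s)%:R * e = \sum_(v <- s) e.
  by rewrite big_const_seq count_predT iter_addr_0 mulr_natl.
by rewrite big_seq [leRHS]big_seq; apply: ler_sum.
Qed.

Lemma norm_bary_sub s v e k : small e s -> v \in s -> (size s <= k.+1)%N ->
  `|bary s - v| <= k%:R / k.+1%:R * e.
Proof.
move=> Hs vs sk; have e0 : 0 <= e by rewrite (le_trans _ (Hs v v vs vs)).
have s0 : s != [::] by case: (s) vs.
rewrite distrC; apply: (le_trans (norm_sub_bary_le v s0)).
(* One of the terms of the average is 0, hence the gain over [e]. *)
rewrite (big_rem v) //= subrr normr0 add0r.
have {sk} : (size s <= k.+1)%N && (0 < size s)%N by rewrite sk lt0n size_eq0.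
case E : (size s) => [|n] /andP[] // nk _.
apply: (@le_trans _ _ (n.+1%:R^-1 * (n%:R * e))).
  rewrite ler_wpM2l ?invr_ge0 //.
  have -> : n%:R * e = \sum_(u <- rem v s) e.
    by rewrite big_const_seq count_predT iter_addr_0 mulr_natl size_rem // E.
  rewrite big_seq [leRHS]big_seq; apply: ler_sum => u /mem_rem us; exact: Hs.
rewrite mulrA ler_wpM2r // mulrC ler_pdivlMr // mulrAC ler_pdivrMr //.
by rewrite -!natrM ler_nat; move: nk; lia.
Qed.

(** Subdividing a simplex of dimension at most k divides its diameter by
    (k + 1) / k at least. *)
Lemma small_subdiv k e s t : (size s <= k.+1)%N -> small e s ->
  t \in subdiv s -> small (k%:R / k.+1%:R * e) t.
Proof.
have [n] := ubnP (size s); elim: n s t => // n IH s t sn sk Hs.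
have [->|s0] := eqVneq s [::]; first by rewrite inE => /eqP->.
rewrite subdivE // => /mapP[u /flatten_mapP[f ff uf] ->].
have [E sub] := mem_faces ff.
have Hu : small (k%:R / k.+1%:R * e) u.
  apply: (IH f) => //; first by rewrite -ltnS -E.
    by rewrite (leq_trans (leqnSn _)) // -E.
  by move=> ? ? /sub ? /sub ?; exact: Hs.
have Hb w : w \in u -> `|bary s - w| <= k%:R / k.+1%:R * e.
  apply: (subdiv_closed (@bary_closed_ball (bary s) _) _ uf) => w' /sub w's.
  exact: norm_bary_sub.
have q0 : 0 <= k%:R / k.+1%:R * e.
  have [v vs] : exists v, v \in s.
    by case: (s) s0 => // v ? _; exists v; rewrite inE eqxx.
  by apply: mulr_ge0 => //; rewrite (le_trans _ (Hs v v vs vs)).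
move=> x y; rewrite !inE => /predU1P[->|xu] /predU1P[->|yu].
- by rewrite subrr normr0.
- exact: Hb.
- by rewrite distrC; exact: Hb.
- exact: Hu.
Qed.

Lemma small_iter_subdiv k e N s t : (size s <= k.+1)%N -> small e s ->
  t \in iter_subdiv N s -> small ((k%:R / k.+1%:R) ^+ N * e) t.
Proof.
elim: N e s => [|N IH] e s sk Hs /=; first by rewrite inE expr0 mul1r => /eqP->.
move=> /flatten_mapP[u us tu]; rewrite exprSr -mulrA; apply: (IH _ u) => //.
  by rewrite (size_subdiv us).
exact: small_subdiv Hs us.
Qed.

End Mesh.

Lemma size_iter_subdiv (R : realType) (V : lmodType R) N (s t : seq V) :
  t \in iter_subdiv N s -> size t = size s.
Proof.
elim: N s => [|N IH] s /=; first by rewrite inE => /eqP->.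
by move=> /flatten_mapP[u /size_subdiv <- /IH].
Qed.

(** * Simplices on products of l1 spheres *)

Section Geometry.
Variables (R : realType) (n : nat).
Local Notation E := 'rV[R]_n.
Local Notation V := (E * E)%type.

(** The two sign changes. *)
Definition flip1 (v : V) : V := (- v.1, v.2).
Definition flip2 (v : V) : V := (v.1, - v.2).

Lemma bary_coord (s : seq E) p :
  bary s ord0 p = (size s)%:R^-1 * \sum_(x <- s) x ord0 p.
Proof. by rewrite /bary mxE summxE. Qed.

Lemma bary_pair (s : seq V) : bary s = (bary (map fst s), bary (map snd s)).
Proof.
rewrite /bary !size_map !big_map.
rewrite [\sum_(v <- s) v](_ : _ = (\sum_(v <- s) v.1, \sum_(v <- s) v.2)) //.
elim: s => [|v s IH]; first by rewrite !big_nil.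
by rewrite !big_cons IH; case: v.
Qed.

Lemma baryN (s : seq E) : bary (map -%R s) = - bary s.
Proof. by rewrite /bary size_map big_map sumrN scalerN. Qed.

Lemma bary_flip1 (s : seq V) : bary (map flip1 s) = flip1 (bary s).
Proof.
rewrite !bary_pair /flip1 /= -baryN -!map_comp.
by congr (bary _, bary _); apply: eq_map.
Qed.

Lemma bary_flip2 (s : seq V) : bary (map flip2 s) = flip2 (bary s).
Proof.
rewrite !bary_pair /flip2 /= -baryN -!map_comp.
by congr (bary _, bary _); apply: eq_map.
Qed.

(** The face of the l1 unit sphere that lies in the closed orthant where the
    p-th coordinate has the sign [eps p], with [true] for negative. *)
Definition orthant_face (eps : 'I_n -> bool) (x : E) : Prop :=
  (forall p, 0 <= (-1) ^+ eps p * x ord0 p) /\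
  \sum_p (-1) ^+ eps p * x ord0 p = 1.

Lemma bary_closed_orthant_face eps : bary_closed (orthant_face eps).
Proof.
move=> s s0 Hs; split=> [p|].
  rewrite bary_coord mulrCA mulr_ge0 ?invr_ge0 // mulr_sumr big_seq sumr_ge0 //.
  by move=> x /Hs[].
under eq_bigr => p _ do rewrite bary_coord mulrCA mulr_sumr.
rewrite -mulr_sumr exchange_big /= big_seq.
rewrite (eq_bigr (fun=> 1)); last by move=> x /Hs[].
rewrite -big_seq big_const_seq count_predT iter_addr_0 mulVf //.
by rewrite pnatr_eq0 size_eq0.
Qed.

Lemma bary_closed_pair (P Q : E -> Prop) : bary_closed P -> bary_closed Q ->
  bary_closed (fun v : V => P v.1 /\ Q v.2).
Proof.
move=> HP HQ s s0 Hs; rewrite bary_pair /=.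
have s1 (f : V -> E) : map f s != [::] by case: (s) s0.
by split; [apply: HP|apply: HQ]; rewrite ?s1 // => x /mapP[v /Hs[? ?] ->].
Qed.

(** The l1 norm. *)
Definition l1 (x : E) : R := \sum_p `|x ord0 p|.

Lemma l1_orthant_face eps x : orthant_face eps x -> l1 x = 1.
Proof.
move=> [H <-]; apply: eq_bigr => p _.
by rewrite -[RHS]ger0_norm // normrM normrX normrN1 expr1n mul1r.
Qed.

(** The i-th basis vector. The index is a natural number, so that vertices can
    be indexed like chains; the vector is 0 when the index is not below [n]. *)
Definition basis_vec (i : nat) : E := \row_p (nat_of_ord p == i)%:R.

(** The vector [x] lies in the face of sign pattern [eps] and only uses the
    coordinates 0, ..., i. *)
Definition carried (i : nat) (eps : 'I_n -> bool) (x : E) : Prop :=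
  orthant_face eps x /\ forall p : 'I_n, (i < p)%N -> x ord0 p = 0.

(** The sign pattern is positive from the coordinate [i] on. Then the i-th basis
    vector lies in the orthant, so coning from it does not leave the orthant. *)
Definition pos_from (i : nat) (eps : 'I_n -> bool) :=
  forall p : 'I_n, (i <= p)%N -> eps p = false.

Lemma carried_basis i eps : (i < n)%N -> pos_from i eps -> carried i eps (basis_vec i).
Proof.
move=> ni He; split=> [|p ip]; last by rewrite mxE gtn_eqF.
split=> [p|].
  rewrite mxE; case: eqP => [pi|_]; last by rewrite mulr0.
  by rewrite He ?pi // mulr1.
rewrite (bigD1 (Ordinal ni)) //= mxE eqxx He //= mulr1 big1 ?addr0 // => p pi.
by rewrite mxE (_ : (p == i :> nat) = false) ?mulr0 //; apply/negbTE.
Qed.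

Lemma carriedS i eps x : carried i eps x -> carried i.+1 eps x.
Proof. by move=> [H1 H2]; split=> // p /ltnW; exact: H2. Qed.

Lemma pos_fromS i eps : pos_from i eps -> pos_from i.+1 eps.
Proof. by move=> H p /ltnW; exact: H. Qed.

(** The sign pattern of the opposite of a vector that only uses the coordinates
    0, ..., i; the irrelevant signs are reset to positive, as [pos_from]
    requires for the next cone. *)
Definition flip_upto (i : nat) (eps : 'I_n -> bool) : 'I_n -> bool :=
  fun p => (p <= i)%N && ~~ eps p.

Lemma pos_from_flip i eps : pos_from i.+1 (flip_upto i eps).
Proof. by move=> p ip; rewrite /flip_upto leqNgt ip. Qed.

Lemma carried_flip i eps x : carried i eps x ->
  carried i.+1 (flip_upto i eps) (- x).
Proof.
move=> [[H1 H2] H3].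
have E p : (-1) ^+ flip_upto i eps p * (- x) ord0 p = (-1) ^+ eps p * x ord0 p.
  rewrite mxE /flip_upto; case: leqP => [_|/H3->]; last by rewrite oppr0 !mulr0.
  by case: (eps p); rewrite /= ?expr0 ?expr1 ?mulrNN ?mulN1r ?mul1r.
split; first split.
- by move=> p; rewrite E.
- by under eq_bigr do rewrite E.
- by move=> p ip; rewrite mxE H3 ?oppr0 // ltnW.
Qed.

(** The apex of D(i, j). *)
Definition apex (i j : nat) : V := (basis_vec i, basis_vec j).

(** The components of all vertices of a simplex of D(i, j) lie in one face each,
    with the sign of the coordinate i (respectively j) positive. *)
Lemma prodchain_carried k i j s : (i + j = k)%N -> (i < n)%N -> (j < n)%N ->
  s \in prodchain flip1 flip2 apex k i j ->
  exists eps del, [/\ pos_from i eps, pos_from j del &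
    forall v, v \in s -> carried i eps v.1 /\ carried j del v.2].
Proof.
elim: k i j s => [|k IH] i j s ijk ni nj /=.
  rewrite inE => /eqP ->; exists (fun=> false), (fun=> false); split=> // v.
  by rewrite inE => /eqP->; split; apply: carried_basis.
move=> /mapP[t tZ ->{s}].
suff [eps [del [He Hd Ht]]] : exists eps del, [/\ pos_from i eps, pos_from j del &
    forall v, v \in t -> carried i eps v.1 /\ carried j del v.2].
  exists eps, del; split=> // v; rewrite inE => /predU1P[->|]; last exact: Ht.
  by split; apply: carried_basis.
move: tZ; rewrite mem_cat => /orP[].
- case: i ijk ni => // i ijk ni; rewrite mem_cat => /orP[tD|/mapP[s sD ->]].
    have [|||eps [del [He Hd Ht]]] := IH i j t _ _ _ tD; [lia|lia|lia|].
    exists eps, del; split=> // [|v /Ht[? ?]]; first exact: pos_fromS.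
    by split=> //; exact: carriedS.
  have [|||eps [del [He Hd Hs]]] := IH i j s _ _ _ sD; [lia|lia|lia|].
  exists (flip_upto i eps), del; split=> //; first exact: pos_from_flip.
  by move=> v /mapP[w /Hs[? ?] ->]; split=> //; exact: carried_flip.
- case: j ijk nj => // j ijk nj; rewrite mem_cat => /orP[tD|/mapP[s sD ->]].
    have [|||eps [del [He Hd Ht]]] := IH i j t _ _ _ tD; [lia|lia|lia|].
    exists eps, del; split=> // [|v /Ht[? ?]]; first exact: pos_fromS.
    by split=> //; exact: carriedS.
  have [|||eps [del [He Hd Hs]]] := IH i j s _ _ _ sD; [lia|lia|lia|].
  exists eps, (flip_upto j del); split=> //; first exact: pos_from_flip.
  by move=> v /mapP[w /Hs[? ?] ->]; split=> //; exact: carried_flip.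
Qed.

(** The product of two l1 unit spheres. *)
Definition l1_pairs : set V := [set v | l1 v.1 = 1] `&` [set v | l1 v.2 = 1].

(** Faces of the l1 sphere are closed under barycenters, so subdividing does not
    leave the product of l1 spheres; in particular it avoids zero vectors. *)
Lemma iter_subdiv_prodchain_l1_pairs N k i j s t v :
  (i + j = k)%N -> (i < n)%N -> (j < n)%N ->
  s \in prodchain flip1 flip2 apex k i j -> t \in iter_subdiv N s -> v \in t ->
  l1_pairs v.
Proof.
move=> ijk ni nj sD ts vt.
have [eps [del [_ _ Hs]]] := prodchain_carried ijk ni nj sD.
have [|H1 H2] := iter_subdiv_closed (bary_closed_pair (@bary_closed_orthant_face eps)
   (@bary_closed_orthant_face del)) _ ts vt.
  by move=> w /Hs[[? _] [? _]].
by split; [exact: l1_orthant_face H1 | exact: l1_orthant_face H2].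
Qed.

(** The norm on row vectors is the sup norm. *)
Lemma norm_le_l1 (x : E) : `|x| <= l1 x.
Proof.
rewrite /Num.norm /= mx_normrE; apply/bigmax_leP; split=> [|[i p] _ /=].
  by rewrite /l1 sumr_ge0.
by rewrite (ord1 i) /l1 (bigD1 p) //= lerDl sumr_ge0.
Qed.

Lemma small_l1_pairs (s : seq V) : (forall v, v \in s -> l1_pairs v) -> small 2 s.
Proof.
move=> Hs u v /Hs[u1 u2] /Hs[v1 v2]; rewrite /= in u1 u2 v1 v2.
have nK (w : V) : l1 w.1 = 1 -> l1 w.2 = 1 -> `|w| <= 1.
  move=> w1 w2; rewrite prod_normE ge_max.
  by rewrite -{1}w1 -w2 !norm_le_l1.
by rewrite (le_trans (ler_normB _ _)) // [leRHS](_ : _ = 1 + 1) ?lerD ?nK.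
Qed.

Lemma continuous_sum_coord (h : 'I_n -> E -> R) :
  (forall p, continuous (h p)) -> continuous (fun x => \sum_p h p x).
Proof.
by move=> Hh; apply: continuous_big => //; exact: add_continuous.
Qed.

Lemma compact_l1 : compact [set x : E | l1 x = 1].
Proof.
apply: bounded_closed_compact.
  exists 1; split=> // M M1 x /= x1; rewrite (le_trans (norm_le_l1 x)) // x1; exact: ltW.
have -> : [set x : E | l1 x = 1] = l1 @^-1` [set z | z = 1] by [].
apply: preimage_closed; last exact: closed_eq.
move=> x _; apply: continuous_sum_coord => p {}x.
exact: cvg_norm (@coord_continuous _ _ _ ord0 p x).
Qed.

Lemma compact_l1_pairs : compact l1_pairs.
Proof.
have -> : l1_pairs = [set x | l1 x = 1] `*` [set x | l1 x = 1] by [].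
exact: compact_setX compact_l1 compact_l1.
Qed.

(** * Signs of biodd functions *)

(** The projection of a nonzero vector to the Euclidean unit sphere. *)
Definition normalize (x : E) : E := (Num.sqrt (dotv x x))^-1 *: x.

Lemma dotvZ c (x : E) d y : dotv (c *: x) (d *: y) = c * d * dotv x y.
Proof. by rewrite /dotv mulr_sumr; apply: eq_bigr => p _; rewrite !mxE mulrACA. Qed.

Lemma dotv_gt0 (x : E) : x != 0 -> 0 < dotv x x.
Proof.
move=> x0; rewrite lt_def sumr_ge0 ?andbT => [|p _]; last by rewrite -expr2 sqr_ge0.
apply: contra_neq x0 => /eqP; rewrite psumr_eq0 => [/allP H|p _].
  apply/rowP => p; rewrite mxE; have /implyP := H p (mem_index_enum p).
  by move=> /(_ isT); rewrite mulf_eq0 orbb => /eqP.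
by rewrite -expr2 sqr_ge0.
Qed.

Lemma sphere_normalize (x : E) : x != 0 -> sphere R n (normalize x).
Proof.
move=> /dotv_gt0 x0; rewrite /sphere /= dotvZ -invfM -expr2 sqr_sqrtr ?ltW //.
by rewrite mulVf ?gt_eqF.
Qed.

Lemma normalizeN (x : E) : normalize (- x) = - normalize x.
Proof. by rewrite /normalize -scaleN1r dotvZ mulrNN !mul1r scaleN1r scalerN. Qed.

Lemma continuous_normalize (x : E) : x != 0 -> {for x, continuous normalize}.
Proof.
move=> x0; have d0 := dotv_gt0 x0.
apply: (@cvgZ _ _ _ (nbhs x) _ _ id); last exact: cvg_id.
apply: cvgV; first by rewrite gt_eqF // sqrtr_gt0.
apply: (@continuous_comp _ _ _ (fun y => dotv y y) Num.sqrt); last exact: sqrt_continuous.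
apply: continuous_sum_coord => p y.
by have C := @coord_continuous R 1 n ord0 p y; exact: (cvgM C C).
Qed.

(** The sign of one nonzero coordinate, the one that [pick] selects. The selected
    index only depends on the support, hence this sign is odd in a nonzero vector. *)
Definition vec_sign (x : E) : bool :=
  if [pick p | x ord0 p != 0] is Some p then 0 < x ord0 p else false.

Lemma vec_signN x : x != 0 -> vec_sign (- x) = ~~ vec_sign x.
Proof.
move=> x0; rewrite /vec_sign.
rewrite (eq_pick (Q := fun p => x ord0 p != 0)); last by move=> p; rewrite mxE oppr_eq0.
case: pickP => [p xp|H]; first by rewrite mxE oppr_gt0 -leNgt le_eqVlt (negbTE xp).
by case/eqP: x0; apply/rowP => p; rewrite mxE; apply/eqP; move: (H p) => /negbFE.
Qed.

Lemma l1_neq0 x : l1 x = 1 -> x != 0.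
Proof.
move=> H; apply/eqP => x0; move: H; rewrite x0 /l1 big1 => [/eqP|p _].
  by rewrite eq_sym oner_eq0.
by rewrite mxE normr0.
Qed.

(** The sign of [f] at the projections of a pair to the unit spheres. Where [f]
    vanishes, a fixed biodd sign is used, so that this boolean is negated by both
    sign changes even there. *)
Definition fsign (f : E -> E -> R) (v : V) : bool :=
  let z := f (normalize v.1) (normalize v.2) in
  (0 < z) || ((z == 0) && (vec_sign v.1 (+) vec_sign v.2)).

Lemma odd_sign_fsign f : odd_fun f -> odd_sign flip1 flip2 l1_pairs (fsign f).
Proof.
move=> Hf v [/l1_neq0 v1 /l1_neq0 v2]; rewrite /fsign /= !normalizeN.
have [-> ->] := Hf _ _ (sphere_normalize v1) (sphere_normalize v2).
rewrite !vec_signN // addbN addNb oppr_gt0 oppr_eq0.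
by case: ltgtP => //= _; rewrite ?orbF; case: (_ (+) _).
Qed.

End Geometry.

(** * The common zero theorem *)

Lemma In_map_ex (T U : Type) (f : T -> U) (r : seq T) y :
  List.In y (map f r) -> exists x, y = f x.
Proof.
by elim: r => //= x r IH [<-|/IH//]; exists x.
Qed.

Lemma cup_sign_change (V : eqType) (I : eqType) (g : I -> V -> bool) r t :
  cup (map g r) t -> forall l, l \in r ->
  exists u v, [/\ u \in t, v \in t & g l u != g l v].
Proof.
elim: r t => // h r IH [|u [|v t]] //= /andP[guv Ht] l.
rewrite inE => /predU1P[->|lr].
  by exists u, v; rewrite !inE !eqxx orbT; split=> //; case: (g h u) guv; case: (g h v).
by have [x [y [xt yt gxy]]] := IH _ Ht l lr; exists x, y; split; rewrite // in_cons ?xt ?yt orbT.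
Qed.

Lemma xsum_true (T : eqType) (r : seq T) (phi : T -> bool) :
  xsum r phi -> exists2 x, x \in r & phi x.
Proof.
elim: r => [|x r IH]; first by rewrite big_nil.
rewrite big_cons; case E: (phi x) => /=; first by exists x; rewrite ?inE ?eqxx.
by move=> /IH[y yr py]; exists y; rewrite // inE yr orbT.
Qed.

Section CommonZero.
Variables (R : realType) (n a b : nat).
Local Notation E := 'rV[R]_n.
Local Notation V := (E * E)%type.
Variable (f : 'I_(a + b) -> E -> E -> R).
Hypothesis (an : (a < n)%N) (bn : (b < n)%N) (odd_bin : odd 'C(a + b, a)).
Hypothesis (f_odd : forall l, odd_fun (f l)).
Hypothesis (f_cont : forall l, sphere_continuous (f l)).

(* The contraction factor of the diameters in dimension a + b. *)
Let q : R := (a + b)%:R / (a + b).+1%:R.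

(** Every subdivision of D(a, b) has a simplex on which all signs change. The
    diameter bound starts from 2, the largest sup-norm distance of two points of
    the l1 unit sphere. *)
Lemma small_sign_changing_simplex (N : nat) : exists t : seq V,
  [/\ t != [::], forall v, v \in t -> @l1_pairs R n v, small (q ^+ N * 2) t &
   forall l, exists u v, [/\ u \in t, v \in t & fsign (f l) u != fsign (f l) v]].
Proof.
pose gs := map (fun l => fsign (f l)) (enum 'I_(a + b)).
have szgs : size gs = (a + b)%N by rewrite size_map size_enum_ord.
have flip1K : involutive (@flip1 R n) by case=> x y; rewrite /flip1 /= opprK.
have flip2K : involutive (@flip2 R n) by case=> x y; rewrite /flip2 /= opprK.
have HK k i j s t v : (i + j = k)%N -> (i <= a)%N -> (j <= b)%N ->
    s \in prodchain (@flip1 R n) (@flip2 R n) (@apex R n) k i j ->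
    t \in iter_subdiv N s -> v \in t -> @l1_pairs R n v.
  move=> ijk ia jb; apply: iter_subdiv_prodchain_l1_pairs => //.
  - exact: leq_ltn_trans an.
  - exact: leq_ltn_trans bn.
have pascal := @xsum_cup_prodchain _ _ _ _ _ flip1K flip2K (fun=> erefl)
  (@bary_flip1 R n) (@bary_flip2 R n) (@l1_pairs R n) N a b HK gs a b szgs
  (leqnn _) (leqnn _).
have /xsum_true[s sD /xsum_true[t ts gst]] : xsum (prodchain (@flip1 R n) (@flip2 R n)
    (@apex R n) (a + b) a b) (iter_cochain N (cup gs)).
  rewrite pascal; first exact: odd_bin.
  by move=> g gIn; have [l ->] := In_map_ex gIn; exact: odd_sign_fsign.
have tK v : v \in t -> l1_pairs v by apply: (HK _ a b) ts.
have szt := cup_size gst; rewrite szgs in szt.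
exists t; split=> //.
- by rewrite -size_eq0 szt.
- apply: (@small_iter_subdiv _ _ (a + b) 2 N s t) => //.
    by rewrite -(size_iter_subdiv ts) szt.
  apply: small_l1_pairs => v.
  apply: (@iter_subdiv_prodchain_l1_pairs _ _ 0 _ _ _ _ s) an bn sD _ => //.
  by rewrite inE.
- by move=> l; apply: (cup_sign_change gst); rewrite mem_enum.
Qed.

Lemma fsign_locally_constant l (p : V) :
  l1_pairs p -> f l (normalize p.1) (normalize p.2) != 0 ->
  \forall v \near p,
    l1_pairs v -> fsign (f l) v = (0 < f l (normalize p.1) (normalize p.2)).
Proof.
move=> [p1 p2] h0.
set h := f l _ _ in h0 *.
have n1 := l1_neq0 p1; have n2 := l1_neq0 p2.
have pS : (sphere R n `*` sphere R n) (normalize p.1, normalize p.2).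
  by split; exact: sphere_normalize.
have nearS : \forall z \near (normalize p.1, normalize p.2),
    (sphere R n `*` sphere R n) z -> 0 < f l z.1 z.2 * h.
  have /subspace_continuousP/(_ _ pS) Hc := @f_cont l.
  have [hn|hp|/eqP] := ltgtP h 0; last by rewrite (negbTE h0).
  - have : \forall z \near within (sphere R n `*` sphere R n)
        (nbhs (normalize p.1, normalize p.2)),
      f l z.1 z.2 < 0 by exact: cvgr_lt Hc _ hn.
    by apply: filterS => z Hz; rewrite nmulr_lgt0.
  - have : \forall z \near within (sphere R n `*` sphere R n)
        (nbhs (normalize p.1, normalize p.2)),
      0 < f l z.1 z.2 by exact: cvgr_gt Hc _ hp.
    by apply: filterS => z Hz; rewrite pmulr_lgt0.
have nc : {for p, continuous (fun v : V => (normalize v.1, normalize v.2))}.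
  apply: (@cvg_pair _ _ _ (nbhs p) (nbhs (normalize p.1)) (nbhs (normalize p.2))).
  - by apply: (@continuous_comp _ _ _ fst (@normalize R n));
      [exact: cvg_fst | exact: continuous_normalize].
  - by apply: (@continuous_comp _ _ _ snd (@normalize R n));
      [exact: cvg_snd | exact: continuous_normalize].
have Hn : \forall v \near p, (sphere R n `*` sphere R n) (normalize v.1, normalize v.2) ->
    0 < f l (normalize v.1) (normalize v.2) * h by exact: nc _ nearS.
apply: (@filterS _ (nbhs p) _ _ _ _ Hn) => v /= Hv [v1 v2].
have {Hv} : 0 < f l (normalize v.1) (normalize v.2) * h.
  by apply: Hv; split; apply: sphere_normalize; exact: l1_neq0.
rewrite /fsign; case: (ltgtP h 0) => [hn|hp|/eqP]; last by rewrite (negbTE h0).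
  by rewrite nmulr_lgt0 // => zn; rewrite lt_eqF // ltNge ltW.
by rewrite pmulr_lgt0 // => ->.
Qed.

(** If a, b < n and the binomial coefficient of a + b over a is odd, any a + b
    continuous functions on pairs of unit vectors of R^n that are odd in each
    variable have a common zero. *)
Theorem biodd_common_zero : exists x y, [/\ sphere R n x, sphere R n y &
  forall l, f l x y = 0].
Proof.
have [T HT] := choice small_sign_changing_simplex.
pose u N : V := head 0 (T N).
have uT N : u N \in T N.
  by have [] := HT N; rewrite /u; case: (T N) => //= v t *; rewrite inE eqxx.
have uK N : l1_pairs (u N) by have [_ TK _ _] := HT N; exact: TK.
have [p [Kp clp]] : @l1_pairs R n `&` cluster (u @ \oo) !=set0.
  by apply: compact_l1_pairs; exists 0%N => // N _; exact: uK.
exists (normalize p.1), (normalize p.2).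
have [p1 p2] := Kp.
split; [exact/sphere_normalize/l1_neq0 | exact/sphere_normalize/l1_neq0 | move=> l].
apply/eqP/negPn/negP => /(fsign_locally_constant Kp) /nbhs_ballP[e /= e0 He].
have q1 : `|q| < 1.
  rewrite ger0_norm ?divr_ge0 // ltr_pdivrMr // mul1r ltr_nat //.
(* A simplex of diameter below e / 2 with a vertex within e / 2 of p lies in the
   ball of radius e around p, where the sign is constant. *)
have e4 : 0 < e / 4 by rewrite divr_gt0.
have Hq : \forall N \near \oo, `|q ^+ N| < e / 4.
  by exact: (cvgr0_norm_lt _ (cvg_expr q1) _ e4).
have [N0 _ HN0] := Hq.
have eh : 0 < e / 2 by rewrite divr_gt0.
have nearU : (u @ \oo) [set v | exists2 N, v = u N & q ^+ N * 2 < e / 2].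
  exists N0 => // N /HN0 /= /ltr_normlW ?; exists N => //; lra.
have [_ [[N -> qN] pB]] := clp _ _ nearU (nbhsx_ballx p _ eh).
have [_ TK Tsmall Tsign] := HT N.
have signE v : v \in T N -> fsign (f l) v = (0 < f l (normalize p.1) (normalize p.2)).
  move=> vT; apply: (He v _ (TK v vT)).
  rewrite (splitr e); apply: (ball_triangle pB).
  rewrite -ball_normE /ball_ /=; apply: (le_lt_trans _ qN); exact: Tsmall.
have [v [w [vT wT]]] := Tsign l.
by rewrite !signE ?eqxx.
Qed.

End CommonZero.

(** * Powers of 2 and the inner product *)

(** All binomial coefficients over 2^t - 1 are odd: two neighbours add up to a
    coefficient over 2^t, which is even strictly inside the row, because 2^t
    divides j times the coefficient over j. *)
Lemma odd_bin_pow2 (t j : nat) : (j < 2 ^ t)%N -> odd 'C((2 ^ t).-1, j).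
Proof.
elim: j => [|j IH] jt; first by rewrite bin0.
have e : odd 'C(2 ^ t, j.+1) = false.
  apply/negbTE/negP => o.
  have := mul_bin_diag (2 ^ t) j; have : coprime (2 ^ t) 'C(2 ^ t, j.+1).
    by rewrite coprimeXl // coprime2n.
  move=> co E; have : (2 ^ t %| j.+1)%N.
    by rewrite -(Gauss_dvdl _ co) -E dvdn_mulr.
  by move=> /dvdn_leq; rewrite [(2 ^ t <= _)%N]leqNgt jt => /(_ isT).
move: e; rewrite -{1}(prednK (expn_gt0 2 t)) binS oddD IH; last exact: ltnW.
by rewrite addbT => /negbFE.
Qed.

(** [P r] is 2^s for the least s with r <= 2^s. *)
Lemma P_pow2 (r : nat) : exists s, [/\ P r = (2 ^ s)%N, (r <= 2 ^ s)%N &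
  forall u, (r <= 2 ^ u)%N -> (s <= u)%N].
Proof.
rewrite /P; case: ex_minnP => p /asboolP[s [-> rs]] H; exists s; split=> // u ru.
by rewrite -(@leq_exp2l 2) //; apply: H; apply/asboolP; exists u.
Qed.

Lemma P_gt_pow2 n t : (2 ^ t < P n)%N = (2 ^ t < n)%N.
Proof.
have [s [-> ns H]] := P_pow2 n; rewrite ltn_exp2l //; apply/idP/idP => [ts|tn].
  by rewrite ltnNge; apply/negP => /H; rewrite leqNgt ts.
by rewrite -(@ltn_exp2l 2) //; exact: leq_trans tn ns.
Qed.

Lemma leP_pow2 m n t : P m = (2 ^ t)%N -> (m <= P n)%N = (2 ^ t <= P n)%N.
Proof.
have [s [-> ms H]] := P_pow2 m; have [u [-> _ _]] := P_pow2 n.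
move=> /eqP; rewrite eqn_exp2l // => /eqP <-; rewrite leq_exp2l //.
by apply/idP/idP => [/H//|su]; apply: (leq_trans ms); rewrite leq_exp2l.
Qed.

Lemma dotvNl (R : realType) n (x y : 'rV[R]_n) : dotv (- x) y = - dotv x y.
Proof. by rewrite -scaleN1r -[y in LHS]scale1r dotvZ mulr1 mulN1r. Qed.

Lemma dotvC (R : realType) n (x y : 'rV[R]_n) : dotv x y = dotv y x.
Proof. by apply: eq_bigr => p _; rewrite mulrC. Qed.

Lemma odd_dotv (R : realType) n : odd_fun (@dotv R n).
Proof. by move=> x y _ _; rewrite dotvNl; split=> //; rewrite dotvC dotvNl dotvC. Qed.

Lemma sphere_continuous_dotv (R : realType) n : sphere_continuous (@dotv R n).
Proof.
apply: continuous_subspaceT; apply: continuous_big; first exact: add_continuous.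
move=> p _ z.
have c1 : (fun z : 'rV[R]_n * 'rV[R]_n => z.1 ord0 p) @ z --> z.1 ord0 p.
  by apply: (@continuous_comp _ _ _ fst (fun x : 'rV[R]_n => x ord0 p));
    [exact: cvg_fst | exact: coord_continuous].
have c2 : (fun z : 'rV[R]_n * 'rV[R]_n => z.2 ord0 p) @ z --> z.2 ord0 p.
  by apply: (@continuous_comp _ _ _ snd (fun x : 'rV[R]_n => x ord0 p));
    [exact: cvg_snd | exact: coord_continuous].
exact: (cvgM c1 c2).
Qed.

Theorem theorem4 (R : realType) (n m : nat) (hn : (0 < n)%N) (hm : (0 < m)%N) :
  ((P n >= m + 2)%N <->
     (n%:R : rat) >= 1 / 2 * (P (m + 2))%:R + 1) /\
  ((P n >= m + 2)%N -> R_odd_sym_orth R (n, m, 2%N)).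
Proof.
have [t Pm] : exists t, P (m + 2) = (2 ^ t.+1)%N.
  have [[|t] [Pm m2 _]] := P_pow2 (m + 2); last by exists t.
  by move: m2; rewrite expn0; lia.
have Pge : (m + 2 <= P n)%N = (2 ^ t < n)%N.
  rewrite (leP_pow2 n Pm) -P_gt_pow2.
  have [u [-> _ _]] := P_pow2 n; by rewrite leq_exp2l // ltn_exp2l.
split.
  rewrite Pge Pm expnS natrM mul1r mulrA mulVf // mul1r.
  by rewrite natr1 ler_nat.
rewrite Pge => tn; split=> // f Hf.
have m2 : (m + 2 <= 2 ^ t.+1)%N by have [s [<- ]] := P_pow2 (m + 2); rewrite -Pm.
pose a := (2 ^ t).-1; pose b := (2 ^ t)%N.
have t0 : (0 < 2 ^ t)%N by rewrite expn_gt0.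
have ab : (a + b = (2 ^ t.+1).-1)%N by rewrite /a /b expnS; lia.
(* The given functions, followed by as many copies of the inner product as are
   needed; there is at least one, since m < a + b. *)
pose F (l : 'I_(a + b)) := if insub (l : nat) is Some l' then f l' else @dotv R n.
have Fcont l : sphere_continuous (F l).
  rewrite /F; case: insubP => [l' _ _|_]; first by have [] := Hf l'.
  exact: sphere_continuous_dotv.
have Fodd l : odd_fun (F l).
  rewrite /F; case: insubP => [l' _ _|_]; first by have [] := Hf l'.
  exact: odd_dotv.
have [|||x [y [xS yS Fxy]]] := biodd_common_zero _ _ _ Fodd Fcont.
- by rewrite /a; lia.
- by rewrite /b.
- by rewrite ab odd_bin_pow2 // /a expnS; lia.
have dxy : dotv x y = 0.
  have ml : (m < a + b)%N by lia.
  have := Fxy (Ordinal ml); rewrite /F insubF //=; exact: ltnn.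
have fxy l : f l x y = 0.
  have lab : (l < a + b)%N by have := ltn_ord l; lia.
  have := Fxy (Ordinal lab); rewrite /F /= insubT //= => lm.
  by have -> : Sub (l : nat) lm = l by exact: val_inj.
exists (fun i : 'I_2 => if i == ord0 then x else y).
  move=> i j; rewrite /sphere /= in xS yS.
  case: i => -[|[|//]] ?; case: j => -[|[|//]] ? //=.
  by rewrite dotvC.
move=> l i j ij.
have -> : i = ord0.
  by apply: val_inj => /=; move: (ltn_ord j) ij; case: (nat_of_ord i) => // k; lia.
rewrite eqxx (_ : (j == ord0) = false) ?fxy //.
by apply/negbTE; rewrite -val_eqE /= -lt0n; exact: leq_ltn_trans ij.
Qed.
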